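(* Let $T$ be a finite tree with $T\neq K_2$, and let $V_{even}(T)$ denote the set of vertices of $T$ of even degree. If $V_{even}(T)$ induces a path in $T$, then $T$ is antimagic.
   Context: All graphs are finite, undirected and simple. A tree is a connected acyclic graph. $V_{even}(T)$ is the set of vertices of $T$ whose degree in $T$ is even. ''$V_{even}(T)$ induces a path'' means that the subgraph of $T$ induced by $V_{even}(T)$ is a path; a single vertex counts as a path, and the case $V_{even}(T)=\emptyset$ is included (the empty set is regarded as inducing the empty path). $K_2$ is the tree with exactly two vertices and one edge. An antimagic labeling of a connected graph $G$ is a bijection $\phi:E(G)\to\{1,2,\dots,|E(G)|\}$ such that the vertex sums $s(v)=\sum_{e\in E(v)}\phi(e)$, $v\in V(G)$, are pairwise distinct, where $E(v)$ is the set of edges incident to $v$. A graph is antimagic if it has an antimagic labeling. *)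

(* Defs.v *)
From mathcomp Require Import all_boot.

Set Implicit Arguments.
Unset Strict Implicit.
Unset Printing Implicit Defensive.

Record sgraph := SGraph {
  vertex :> finType;
  adj : rel vertex;
  adj_sym : symmetric adj;
  adj_irrefl : irreflexive adj
}.

Definition edges (G : sgraph) : {set {set G}} :=
  [set [set xy.1; xy.2] | xy in [pred xy : G * G | adj xy.1 xy.2]].

Definition incident_edges (G : sgraph) (v : G) : {set {set G}} :=
  [set e in edges G | v \in e].

Definition degree (G : sgraph) (v : G) : nat := #|incident_edges v|.

Definition connected (G : sgraph) : Prop :=
  0 < #|G| /\ forall x y : G, connect (@adj G) x y.

(* [ucycle adj c] also holds of [::] and, for adjacent x and y, of [:: x; y];
   the genuine cycles of a simple graph are those of length at least 3. *)
Definition acyclic (G : sgraph) : Prop :=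
  forall c : seq G, ucycle (@adj G) c -> size c < 3.

Definition tree (G : sgraph) : Prop := connected G /\ acyclic G.

Definition is_K2 (G : sgraph) : Prop :=
  [/\ tree G, #|G| = 2 & #|edges G| = 1].

Definition isomorphic (G H : sgraph) : Prop :=
  exists2 f : G -> H, bijective f & forall x y : G, adj (f x) (f y) = adj x y.

Definition induced_adj (G : sgraph) (S : {set G}) : rel {x : G | x \in S} :=
  fun x y => adj (val x) (val y).

Lemma induced_adj_sym (G : sgraph) (S : {set G}) : symmetric (@induced_adj G S).
Proof. by move=> x y; apply: adj_sym. Qed.

Lemma induced_adj_irrefl (G : sgraph) (S : {set G}) :
  irreflexive (@induced_adj G S).
Proof. by move=> x; apply: adj_irrefl. Qed.

Definition induced (G : sgraph) (S : {set G}) : sgraph :=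
  SGraph (@induced_adj_sym G S) (@induced_adj_irrefl G S).

Definition path_adj (n : nat) : rel 'I_n :=
  fun i j => (i.+1 == j) || (j.+1 == i).

Lemma path_adj_sym (n : nat) : symmetric (@path_adj n).
Proof. by move=> i j; rewrite /path_adj orbC. Qed.

Lemma path_adj_irrefl (n : nat) : irreflexive (@path_adj n).
Proof. by move=> i; rewrite /path_adj orbb gtn_eqF. Qed.

Definition path_graph (n : nat) : sgraph :=
  SGraph (@path_adj_sym n) (@path_adj_irrefl n).

(* The empty path (n = 0) and the one-vertex path (n = 1) are included. *)
Definition induces_path (G : sgraph) (S : {set G}) : Prop :=
  exists n : nat, isomorphic (induced S) (path_graph n).

Definition V_even (G : sgraph) : {set G} := [set v | ~~ odd (degree v)].

Definition vertex_sum (G : sgraph) (phi : {set G} -> nat) (v : G) : nat :=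
  \sum_(e in incident_edges v) phi e.

(* A labeling is a function on all sets of vertices, of which only the values
   on edges matter; the first three clauses say that it restricts to a
   bijection from the edge set onto {1, ..., #|edges G|}. *)
Definition antimagic_labeling (G : sgraph) (phi : {set G} -> nat) : Prop :=
  [/\ {in edges G, forall e, 1 <= phi e <= #|edges G|},
      {in edges G &, injective phi},
      forall k, 1 <= k <= #|edges G| -> exists2 e, e \in edges G & phi e = k
    & injective (vertex_sum phi)].

Definition antimagic (G : sgraph) : Prop :=
  exists phi : {set G} -> nat, antimagic_labeling phi.

(* Main.v *)
Require Import Defs.
From mathcomp Require Import all_boot.
From mathcomp Require Import zify.

Set Implicit Arguments.
Unset Strict Implicit.
Unset Printing Implicit Defensive.

(** A tree with one vertex has no two sums to compare.  Otherwise, let m be the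
    number of edges.  Extend the path v_1, ..., v_k formed by the
    vertices of even degree at both ends by vertices v_0 and v_(k+1) of odd
    degree, and root the tree at v_0; call v_0, ..., v_(k+1) the spine.  Parity
    of the degrees says exactly that every vertex has an even number of
    children outside the spine.  Hence the edges off the spine split into pairs
    of sibling edges, and the labels used there can be chosen so that the two
    labels of a pair always add up to a constant S ([pairing_labels]).  If v has
    2q children off the spine, these contribute q S to the vertex sum of v.
    Modulo S the sum of a vertex off the spine is therefore the label of its
    parent edge, which already separates these vertices from one another.

    It remains to label the k + 1 edges of the spine.  The labels left for them
    are those with a residue in [-lo, lo] modulo S, for a small number lo; they
    are ordered in such a way that the sum of two consecutive ones again has
    its residue in [-lo, lo], so that vertices of the spine never meet vertices
    off it.  Zigzags, which alternate between small and large labels, achieve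
    this: their consecutive sums form an arithmetic progression, except perhaps
    near the two ends.

    If k is odd, one zigzag gives pairwise distinct residues on the spine and
    the proof is complete ([spine_labels_odd]).  If k = 2l is even, each of four
    zigzags has at most one coincidence of residues, between two particular
    vertices of the spine.  With p_i half the number of children of v_i off the
    spine, the two sums really agree only if, respectively,
      p_0 = p_(l+1),   p_1 = p_(l+1),   p_1 = p_(l+2),   p_0 = p_(l+2) + 1.
    These four equations contradict each other, so one zigzag is good, whatever
    the tree is ([spine_labels_exist]).  When k = 0 only the first zigzag exists;
    there v_0 is chosen to be a leaf, so that p_0 = 0, while p_1 is positive
    because the tree is not K_2. *)

(** * Edges and neighbours *)

Section Neighbours.

Variable G : sgraph.

Definition neighbours (v : G) : {set G} := [set x | adj v x].

Lemma mem_edges (x y : G) : ([set x; y] \in edges G) = adj x y.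
Proof.
apply/imsetP/idP => [[[a b]] /= | xy]; last by exists (x, y).
rewrite inE /= => ab eq_xy.
have ba : adj b a by rewrite adj_sym.
have xE : x \in [set a; b] by rewrite -eq_xy set21.
have yE : y \in [set a; b] by rewrite -eq_xy set22.
have aE : a \in [set x; y] by rewrite eq_xy set21.
have bE : b \in [set x; y] by rewrite eq_xy set22.
move: xE yE aE bE; rewrite !inE.
case/orP=> /eqP ex; case/orP=> /eqP ey; subst x y; rewrite ?ab ?ba // !orbb.
  by move=> _ /eqP eq_ab; rewrite eq_ab adj_irrefl in ab.
by move=> /eqP eq_ab; rewrite eq_ab adj_irrefl in ab.
Qed.

Lemma mem_edges_adj e : e \in edges G -> exists2 xy : G * G,
  adj xy.1 xy.2 & e = [set xy.1; xy.2].
Proof. by case/imsetP => xy; rewrite inE => ? ->; exists xy. Qed.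

Lemma set2_inj (v : G) : injective (fun x => [set v; x]).
Proof.
move=> x y eq_xy.
have: x \in [set v; y] by rewrite -eq_xy set22.
have: y \in [set v; x] by rewrite eq_xy set22.
by rewrite !inE => /orP[]/eqP ? /orP[]/eqP ?; subst.
Qed.

Lemma incident_edgesE (v : G) :
  incident_edges v = (fun x => [set v; x]) @: neighbours v.
Proof.
apply/setP => e; rewrite inE; apply/andP/imsetP => [[eE ve] | [x]].
  case/mem_edges_adj: eE ve => -[a b] /= ab -> ; rewrite !inE.
  case/orP => /eqP ->; first by exists b; rewrite ?inE.
  by exists a; rewrite ?inE 1?adj_sym // setUC.
by rewrite inE => vx ->; rewrite mem_edges set21.
Qed.

Lemma degreeE (v : G) : degree v = #|neighbours v|.
Proof. by rewrite /degree incident_edgesE (card_imset _ (@set2_inj v)). Qed.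

Lemma vertex_sumE phi (v : G) :
  vertex_sum phi v = \sum_(x in neighbours v) phi [set v; x].
Proof.
by rewrite /vertex_sum incident_edgesE big_imset //= => x y _ _ /set2_inj.
Qed.

End Neighbours.

(** * Rooted trees *)

(** [adj_par] and [par_asym] together say that every edge has exactly one end
    whose parent is the other end. *)
Record rooted (G : sgraph) (r : G) (par : G -> G) : Prop := Rooted {
  par_adj : forall x, x != r -> adj x (par x);
  adj_par : forall x y, adj x y ->
    (x != r /\ par x = y) \/ (y != r /\ par y = x);
  par_asym : forall x y, x != r -> y != r -> par x = y -> par y <> x
}.

Section Rooting.

Variable G : sgraph.
Hypothesis treeG : tree G.

Definition avoiding (y : G) : rel G :=
  fun a b => [&& adj a b, a != y & b != y].

Lemma avoiding_sym y : connect_sym (avoiding y).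
Proof.
by apply: sym_connect_sym => a b; rewrite /avoiding /= adj_sym (andbC (a != y)).
Qed.

Lemma path_avoiding y x p : x != y ->
  path (avoiding y) x p = path (@adj G) x p && (y \notin p).
Proof.
elim: p x => [|z p IH] x xy //=; rewrite {1}/avoiding inE negb_or xy /= (eq_sym y z).
case: (eqVneq z y) => [|zy]; first by rewrite !andbF.
by rewrite IH // !andbT -andbA.
Qed.

(** A path from [x] to [z] that misses their common neighbour [y] would close
    up to a cycle through [y]. *)
Lemma avoiding_inj y x z :
  adj y x -> adj y z -> connect (avoiding y) x z -> x = z.
Proof.
move=> yx yz /connectP[p xp zE]; move: zE; case/shortenP: xp => q xq uq _ zE.
have neq_xy : x != y by apply: contraTneq yx => ->; rewrite adj_irrefl.
move: xq; rewrite path_avoiding // => /andP[xq yq].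
have: ucycle (@adj G) (y :: x :: q).
  rewrite /ucycle /= rcons_path yx xq -zE adj_sym yz /= inE negb_or.
  by rewrite eq_sym neq_xy yq.
by move/(treeG.2) => /=; case: (q) zE.
Qed.

Variable r : G.

(** The neighbour of [x] from which the root can be reached without passing
    through [x]; it is unique by [avoiding_inj]. *)
Definition parent (x : G) : G :=
  odflt x [pick y | adj x y && connect (avoiding x) y r].

Lemma parentE x y : adj x y -> connect (avoiding x) y r -> parent x = y.
Proof.
move=> xy yr; rewrite /parent.
case: pickP => [z /andP[xz zr] | /(_ y)]; last by rewrite xy yr.
apply: (@avoiding_inj x) => //.
by apply: connect_trans zr _; rewrite avoiding_sym.
Qed.

Lemma toward_root x : x != r -> exists2 y, adj x y & connect (avoiding x) y r.
Proof.
move=> xr; case/connectP: (treeG.1.2 x r) => p xp rE; move: rE.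
case/shortenP: xp => -[|y q] /= xq uq _ rE; first by rewrite rE eqxx in xr.
case/andP: xq => xy yq; exists y => //; apply/connectP; exists q => //.
case/andP: uq; rewrite inE negb_or => /andP[neq xq] _.
by rewrite path_avoiding ?yq // eq_sym.
Qed.

(** For an edge [x y], follow a simple path from [x] to the root: if it misses
    [y] then [x] is the parent of [y], and otherwise its part after [y] shows
    that [y] is the parent of [x].  If both held, the step after [y] on a
    path from [y] that misses [x] would be a second parent of [y]. *)
Lemma parent_rooted : rooted r parent.
Proof.
split.
- by move=> x /toward_root[y xy yr]; rewrite (parentE xy yr).
- move=> x y xy; have neq_xy : x != y.
    by apply: contraTneq xy => ->; rewrite adj_irrefl.
  case/connectP: (treeG.1.2 x r) => p xp rE; move: rE.
  case/shortenP: xp => q xq uq _ rE.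
  have yx : adj y x by rewrite adj_sym.
  case: (boolP (y \in q)) => [yq | y_notin]; last first.
    right; have xr : connect (avoiding y) x r.
      by apply/connectP; exists q; rewrite ?path_avoiding ?xq.
    split; last exact: parentE.
    rewrite rE; apply: contraNneq y_notin => yE.
    by move: (mem_last x q); rewrite -yE inE eq_sym (negPf neq_xy).
  left; case/splitPr: yq xq uq rE => q1 q2.
  rewrite cat_path last_cat /= => /and3P[_ _ yq2].
  rewrite mem_cat inE !negb_or -!andbA => /and4P[_ _ x_q2 uq] rE.
  split; last first.
    apply: parentE => //; apply/connectP; exists q2 => //.
    by rewrite path_avoiding ?yq2 // eq_sym.
  apply: contraNneq x_q2 => xE; move: neq_xy (mem_last y q2).
  by rewrite -rE xE inE => /negPf->.
- move=> x y xr yr xE yE; case: (toward_root xr) => z xz /[dup] zr.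
  rewrite -(parentE xz zr) xE => /connectP[p yp rE]; move: rE.
  case/shortenP: yp => -[|w q] yq uq _ /= rE; first by rewrite rE eqxx in yr.
  move: yq => /= /andP[/and3P[yw _ wx] wq].
  case/andP: uq; rewrite inE negb_or => /andP[neq_yw yq] _.
  have: parent y = w.
    apply: parentE => //; apply/connectP; exists q => //.
    rewrite path_avoiding ?yq 1?eq_sym // andbT.
    by apply: sub_path wq => c d /and3P[].
  by rewrite yE => xw; rewrite xw eqxx in wx.
Qed.

End Rooting.

(** * Labelling edges by their lower ends *)

Section VertexLabels.

Variables (G : sgraph) (r : G) (par : G -> G).
Hypothesis rootedG : rooted r par.

Definition children (v : G) : {set G} := [set c | c != r & par c == v].

Lemma big_neighbours (v : G) (F : G -> nat) :
  \sum_(x in neighbours v) F x =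
  (v != r) * F (par v) + \sum_(c in children v) F c.
Proof.
have [parP adjP asymP] := rootedG.
have adj_child c : c \in children v -> adj v c.
  by rewrite inE adj_sym => /andP[cr /eqP<-]; apply: parP.
have [vr | vr] /= := eqVneq v r.
  rewrite mul0n add0n; apply: eq_bigl => x; rewrite inE; apply/idP/idP.
    by case/adjP=> [][]; rewrite ?vr ?eqxx // inE => -> ->; rewrite eqxx.
  exact: adj_child.
rewrite mul1n (bigD1 (par v)) /=; last by rewrite inE parP.
congr (_ + _); apply: eq_bigl => x; rewrite inE; apply/andP/idP.
  case=> /adjP[][xr xE]; first by rewrite xE eqxx.
  by rewrite inE xr xE eqxx.
move=> xc; split; first exact: adj_child.
move: xc; rewrite inE => /andP[xr /eqP xv].
by apply/eqP => xE; apply: (asymP x v).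
Qed.

Lemma degree_rooted v : degree v = (v != r) + #|children v|.
Proof. by rewrite degreeE -!sum1_card big_neighbours muln1. Qed.

Definition parent_edge (v : G) : {set G} := [set v; par v].

Lemma parent_edge_inj : {in [set~ r] &, injective parent_edge}.
Proof.
have [_ _ asymP] := rootedG.
move=> x y; rewrite !in_setC1 => xr yr eq_xy; apply/eqP/negPn/negP => neq_xy.
have: x \in parent_edge y by rewrite -eq_xy set21.
have: y \in parent_edge x by rewrite eq_xy set21.
rewrite !inE eq_sym (negPf neq_xy) /= => /eqP yE /eqP xE.
exact: (asymP x y).
Qed.

Lemma edges_rooted : edges G = parent_edge @: [set~ r].
Proof.
have [parP adjP _] := rootedG.
apply/setP => e; apply/idP/imsetP => [/mem_edges_adj[[x y] /= xy ->] | [x]].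
  case: (adjP _ _ xy) => -[xr xE].
    by exists x; rewrite ?in_setC1 // /parent_edge xE.
  by exists y; rewrite ?in_setC1 // /parent_edge xE setUC.
by rewrite in_setC1 => xr ->; rewrite mem_edges parP.
Qed.

Lemma card_edges_rooted : #|edges G| = #|G|.-1.
Proof.
by rewrite edges_rooted (card_in_imset parent_edge_inj) cardsC1.
Qed.

(** Sending a vertex to its parent edge matches the vertices other than the
    root with the edges, so an edge labelling is a labelling of these vertices.
    The root has no parent edge, and the label 0 makes its sum fit the general
    formula.  Surjectivity onto the labels follows by counting. *)
Lemma antimagic_of_vertex_labels (ell : G -> nat) :
    ell r = 0 ->
    {in [set~ r], forall v, 0 < ell v < #|G|} ->
    {in [set~ r] &, injective ell} ->
    injective (fun v => ell v + \sum_(c in children v) ell c) ->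
  antimagic G.
Proof.
move=> ell_r ell_range ell_inj sum_inj.
pose phi e := \sum_(v in [set~ r] | e == parent_edge v) ell v.
have phiE v : v \in [set~ r] -> phi (parent_edge v) = ell v.
  move=> vr; rewrite /phi (big_pred1 v) // => w /=.
  apply/andP/eqP => [[wr /eqP] | ->]; last by rewrite vr.
  by move/parent_edge_inj=> ->.
have phi_range: {in edges G, forall e, 1 <= phi e <= #|edges G|}.
  move=> e; rewrite card_edges_rooted edges_rooted => /imsetP[v vr ->].
  by rewrite phiE //; move: (ell_range v vr); lia.
have phi_inj: {in edges G &, injective phi}.
  move=> e f; rewrite edges_rooted => /imsetP[v vr ->] /imsetP[w wr ->].
  by rewrite !phiE // => /ell_inj->.
exists phi; split=> //.
- move=> k k_range.
  have: k \in image phi (edges G).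
    have sub: {subset image phi (edges G) <= iota 1 #|edges G|}.
      move=> _ /imageP[e eE ->]; rewrite mem_iota.
      by move: (phi_range e eE); lia.
    have uniq_im: uniq (image phi (edges G)).
      by rewrite map_inj_in_uniq ?enum_uniq // => e f;
        rewrite !mem_enum; apply: phi_inj.
    have [//|_ ->] := uniq_min_size uniq_im sub.
      by rewrite size_iota size_image.
    by rewrite mem_iota; lia.
  by case/imageP => e eE ->; exists e.
- move=> v w; rewrite !vertex_sumE !big_neighbours => eq_vw.
  apply: sum_inj; move: eq_vw.
  have sumE u : (u != r) * phi [set u; par u] +
      \sum_(c in children u) phi [set u; c] =
      ell u + \sum_(c in children u) ell c.
    congr (_ + _).
      have [->|ur] := eqVneq u r; first by rewrite mul0n ell_r.
      by rewrite mul1n -/(parent_edge u) phiE // in_setC1.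
    apply: eq_bigr => c; rewrite inE => /andP[cr /eqP <-].
    by rewrite setUC -/(parent_edge c) phiE // in_setC1.
  by rewrite !sumE.
Qed.

End VertexLabels.

(** * Pairing siblings *)

(** Remove two elements [x], [y] of a common fibre, give them the extreme labels
    [lo + 1] and [S - (lo + 1)], and label the rest inside the smaller interval
    that remains. *)
Lemma pairing_labels (X : finType) (Y : eqType) (par : X -> Y) (N : {set X})
    (lo S : nat) :
    (forall y, ~~ odd #|[set x in N | par x == y]|) -> #|N| + lo.*2 < S ->
  exists f : X -> nat,
    [/\ {in N &, injective f}, {in N, forall x, lo < f x < S - lo}
      & forall y, \sum_(x in N | par x == y) f x =
          #|[set x in N | par x == y]|./2 * S].
Proof.
have [n] := ubnP #|N|; elim: n N lo => // n IH N lo leNn evenN ltNS.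
have [-> | /set0Pn[x xN]] := eqVneq N set0.
  exists (fun=> 0); split=> [x y | x | y]; rewrite ?inE //.
  rewrite big1 => [|x]; last by rewrite inE.
  by rewrite (_ : [set _ in _ | _] = set0) ?cards0 //;
    apply/setP => x; rewrite !inE.
have /set0Pn[y]: [set z in N | par z == par x] :\ x != set0.
  rewrite -card_gt0; move: (evenN (par x)).
  by rewrite (cardsD1 x [set _ in _ | _]) inE xN eqxx /=; case: #|_|.
rewrite !inE => /and3P[neq_yx yN /eqP par_yx].
pose N' := N :\ x :\ y.
have cardN : #|N| = #|N'|.+2.
  by rewrite (cardsD1 x) xN (cardsD1 y (N :\ x)) !inE neq_yx yN.
have fiberE z (F : X -> nat) : \sum_(t in N | par t == z) F t =
    (par x == z) * (F x + F y) + \sum_(t in N' | par t == z) F t.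
  have [xz | xz] /= := eqVneq (par x) z; last first.
    rewrite mul0n; apply: eq_bigl => t; rewrite !inE.
    have [->|_] := eqVneq t y; first by rewrite par_yx (negPf xz) andbF.
    by have [->|_] := eqVneq t x; first by rewrite (negPf xz) !andbF.
  rewrite (bigD1 x) ?xN ?xz ?eqxx //= (bigD1 y); last first.
    by rewrite yN par_yx xz eqxx.
  rewrite mul1n addnA; congr (_ + _); apply: eq_bigl => t; rewrite !inE.
  by case: (t == x) (t == y) => -[]; rewrite /= ?andbF ?andbT.
have card_fiber z : #|[set t in N | par t == z]| =
    (par x == z).*2 + #|[set t in N' | par t == z]|.
  have cardE (M : {set X}) :
      #|[set t in M | par t == z]| = \sum_(t in M | par t == z) 1.
    by rewrite -sum1_card; apply: eq_bigl => t; rewrite inE.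
  by rewrite !cardE fiberE muln2.
have [|||f [f_inj f_range f_sum]] := IH N' lo.+1.
- by lia.
- by move=> z; move: (evenN z); rewrite card_fiber oddD odd_double.
- by rewrite cardN in ltNS; lia.
have lo_lt : lo.+1 < S - lo.+1 by move: ltNS; rewrite cardN; lia.
pose g z := if z == x then lo.+1 else if z == y then S - lo.+1 else f z.
have gx : g x = lo.+1 by rewrite /g eqxx.
have gy : g y = S - lo.+1 by rewrite /g (negPf neq_yx) eqxx.
have gf t : t != x -> t != y -> g t = f t.
  by rewrite /g => /negPf-> /negPf->.
have gP t : t \in N -> [\/ t = x /\ g t = lo.+1, t = y /\ g t = S - lo.+1
                         | [/\ t \in N', g t = f t & lo.+1 < g t < S - lo.+1]].
  move=> tN; have [->|tx] := eqVneq t x; first by constructor 1.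
  have [->|ty] := eqVneq t y; first by constructor 2.
  have tN' : t \in N' by rewrite !inE ty tx.
  by constructor 3; rewrite gf // f_range.
exists g; split.
- move=> s t /gP[[-> ->]|[-> ->]|[sN' gs g_s]] /gP[[-> ->]|[-> ->]|[tN' gt g_t]];
    try by []; try lia.
  by rewrite gs gt; apply: f_inj.
- by move=> t /gP[[_ ->]|[_ ->]|[_ _]]; lia.
- move=> z; rewrite fiberE gx gy card_fiber.
  rewrite (eq_bigr f) ?f_sum; last first.
    by move=> t; rewrite !inE => /andP[/and3P[ty tx _] _]; rewrite gf.
  rewrite halfD odd_double doubleK /= add0n mulnDl; congr (_ + _).
  by case: (par x == z); lia.
Qed.

(** * Labelling the spine *)

(** [a i] is the label of the edge from vertex [i - 1] to vertex [i] of a spine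
    with vertices [0, ..., k + 1]; the two zeros at the ends let the sum at every
    vertex [i] of the spine be [a i + a i.+1 + p i * S].  The last field shifts
    these sums by [lo], so that the residues in [-lo, lo] become the remainders
    [rho] in [0, 2 lo], and says that no two sums are equal.  The value
    [S = m - k + 2 lo] leaves exactly m - k - 1 labels strictly between [lo] and
    [S - lo], one for each edge off the spine. *)
Record spine_labels (k m : nat) (p : nat -> nat) (lo S : nat)
    (a : nat -> nat) : Prop := SpineLabels {
  sl_modulus : m + lo.*2 = k + S;
  sl_lo : lo <= k.+1;
  sl_first : a 0 = 0;
  sl_last : a k.+2 = 0;
  sl_range : forall i, 0 < i <= k.+1 -> 0 < a i <= m;
  sl_outer : forall i, 0 < i <= k.+1 -> (a i <= lo) || (S <= a i + lo);
  sl_inj : forall i j, 0 < i <= k.+1 -> 0 < j <= k.+1 -> a i = a j -> i = j;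
  sl_residues : exists (rho : nat -> nat) (c : nat -> bool),
    (forall i, i <= k.+1 ->
       a i + a i.+1 + lo = c i * S + rho i /\ rho i <= lo.*2) /\
    (forall i j, i < j <= k.+1 -> rho i = rho j -> c i + p i <> c j + p j)
}.

(** The labels are l+1, m, l, m-1, ..., 1, m-l, with S = m+1: the consecutive sums
    decrease by 1, and the residues of the sums are l+1, l, ..., -(l+1). *)
Lemma spine_labels_odd l m p : l.*2.+2 <= m ->
  exists lo S a, spine_labels l.*2.+1 m p lo S a.
Proof.
move=> le_m.
exists l.+1, m.+1, (fun i => if (i == 0) || (l.*2.+2 < i) then 0
  else if odd i then l.+1 - i./2 else m.+1 - i./2).
split=> //.
- by lia.
- by lia.
- by rewrite ltnSn orbT.
- by move=> i; do ?case: ifP; lia.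
- by move=> i; do ?case: ifP; lia.
- by move=> i j; do ?case: ifP; lia.
- exists (fun i => l.*2.+2 - i), (fun i => 0 < i); split.
    by move=> i; case: i => [|i] /=; do ?case: ifP; lia.
  by move=> i j; lia.
Qed.

(** The labels are m, l, m-1, l-1, ..., 1, m-l, with S = m: the consecutive sums
    run from m+l down to m-l+1 and pass m, of residue 0, at vertex l+1, where
    they meet the sum at vertex 0. *)
Lemma spine_labels_decreasing l m p : l.*2 < m -> p 0 <> p l.+1 ->
  exists lo S a, spine_labels l.*2 m p lo S a.
Proof.
move=> le_m p0.
exists l, m, (fun i => if (i == 0) || (l.*2.+1 < i) then 0
  else if odd i then m - i./2 else l.+1 - i./2).
split=> //.
- by lia.
- by lia.
- by rewrite ltnSn orbT.
- by move=> i; do ?case: ifP; lia.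
- by move=> i; do ?case: ifP; lia.
- by move=> i j; do ?case: ifP; lia.
- exists (fun i => if i == 0 then l else l.*2.+1 - i), (fun=> true); split.
    by move=> i; case: i => [|i] /=; do ?case: ifP; lia.
  move=> i j ij rho_ij /addnI pij; apply: p0.
  have [i0 jl] : i = 0 /\ j = l.+1; last by rewrite i0 jl in pij.
  by move: rho_ij; do ?case: ifP; lia.
Qed.

(** Here and in the next two lemmas S = m+2, the labels of residues -(l+1), ..., -2
    take the even places of the spine in this order, and the labels 1, ..., l+1
    take the odd places.  With the latter in increasing order, the consecutive
    sums have residues -l, ..., l-1.  Vertex 0 gets the sum 1, and
    vertex l+2, if it is an inner one, the sum S+1 of the same residue. *)
Lemma spine_labels_increasing l m p : 0 < l -> l.*2 < m -> p 0 <> (p l.+2).+1 ->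
  exists lo S a, spine_labels l.*2 m p lo S a.
Proof.
move=> l_gt0 le_m p0.
exists l.+1, m.+2, (fun i => if (i == 0) || (l.*2.+1 < i) then 0
  else if odd i then i./2.+1 else m - l + i./2).
split=> //.
- by lia.
- by lia.
- by rewrite ltnSn orbT.
- by move=> i; do ?case: ifP; lia.
- by move=> i; do ?case: ifP; lia.
- by move=> i j; do ?case: ifP; lia.
- exists (fun i => if i == 0 then l.+2 else if i == l.*2.+1 then l.*2.+2 else i),
    (fun i => 0 < i <= l.*2); split.
    move=> i; case: (boolP (0 < i <= l.*2)) => i_mid; do ?case: ifP; lia.
  move=> i j ij rho_ij pij; apply: p0.
  have [i0 [jl jle]] : i = 0 /\ j = l.+2 /\ j <= l.*2.
    by move: rho_ij; do ?case: ifP; lia.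
  by rewrite jl in jle; rewrite i0 jl ltn0Sn jle in pij; lia.
Qed.

(** The small labels in the order l+1, 1, 2, ..., l.  Now the
    residue l+1 at vertex 0 occurs only once; instead, vertex 1 gets the sum S,
    and so does vertex l+2, if it is an inner one. *)
Lemma spine_labels_rotated l m p : 0 < l -> l.*2 < m -> p 1 <> p l.+2 ->
  exists lo S a, spine_labels l.*2 m p lo S a.
Proof.
move=> l_gt0 le_m p0.
exists l.+1, m.+2, (fun i => if (i == 0) || (l.*2.+1 < i) then 0
  else if odd i then (if i == 1 then l.+1 else i./2) else m - l + i./2).
split=> //.
- by lia.
- by lia.
- by rewrite ltnSn orbT.
- by move=> i; do ?case: ifP; lia.
- by move=> i; do ?case: ifP; lia.
- by move=> i j; do ?case: ifP; lia.
- exists (fun i => if i == 0 then l.*2.+2 else if i == 1 then l.+1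
    else if i == l.*2.+1 then l.*2.+1 else i.-1),
    (fun i => 0 < i <= l.*2); split.
    move=> i; case: (boolP (0 < i <= l.*2)) => i_mid; do ?case: ifP; lia.
  move=> i j ij rho_ij pij; apply: p0.
  have [i0 [jl jle]] : i = 1 /\ j = l.+2 /\ j <= l.*2.
    by move: rho_ij; do ?case: ifP; lia.
  by rewrite jl in jle; rewrite i0 jl ltn0Sn jle in pij; lia.
Qed.

(** The small labels in the order l, 1, 2, ..., l-1, l+1.  Vertex 1 now gets
    the sum S-1, and so does vertex l+1, if l > 1. *)
Lemma spine_labels_split l m p : 0 < l -> l.*2 < m -> p 1 <> p l.+1 ->
  exists lo S a, spine_labels l.*2 m p lo S a.
Proof.
move=> l_gt0 le_m p0.
exists l.+1, m.+2, (fun i => if (i == 0) || (l.*2.+1 < i) then 0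
  else if odd i then (if i == 1 then l else if i == l.*2.+1 then l.+1 else i./2)
  else m - l + i./2).
split=> //.
- by lia.
- by lia.
- by rewrite ltnSn orbT.
- by move=> i; do ?case: ifP; lia.
- by move=> i; do ?case: ifP; lia.
- by move=> i j; do ?case: ifP; lia.
- exists (fun i => if i == 0 then l.*2.+1 else if i == 1 then l
    else if i == l.*2.+1 then l.*2.+2 else if i == l.*2 then i else i.-1),
    (fun i => 0 < i <= l.*2); split.
    move=> i; case: (boolP (0 < i <= l.*2)) => i_mid; do ?case: ifP; lia.
  move=> i j ij rho_ij pij; apply: p0.
  have [i0 [jl jle]] : i = 1 /\ j = l.+1 /\ j <= l.*2.
    by move: rho_ij; do ?case: ifP; lia.
  by rewrite jl in jle; rewrite i0 jl ltn0Sn jle in pij; lia.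
Qed.

(** For even k the four possible obstructions give
    p_0 = p_(l+1) = p_1 = p_(l+2) = p_0 - 1. *)
Lemma spine_labels_exist k m p :
    k < m -> (k = 0 -> p 0 <> p 1) ->
  exists lo S a, spine_labels k m p lo S a.
Proof.
move=> lt_km p01; have := odd_double_half k.
case: (boolP (odd k)) => [odd_k | even_k] /= kE.
  by rewrite -kE add1n; apply: spine_labels_odd; lia.
rewrite -kE add0n; set l := k./2 in kE *.
have lt_lm : l.*2 < m by lia.
case: (eqVneq (p 0) (p l.+1)) => [p0 | /eqP]; last exact: spine_labels_decreasing.
have l_gt0 : 0 < l by rewrite lt0n; apply/eqP => l0; rewrite l0 in kE p0; apply: p01.
case: (eqVneq (p 1) (p l.+1)) => [p1 | /eqP]; last exact: spine_labels_split.
case: (eqVneq (p 1) (p l.+2)) => [p2 | /eqP]; last exact: spine_labels_rotated.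
by apply: spine_labels_increasing; lia.
Qed.

(** * Trees with a spine *)

Lemma quotient_inj S a b x y :
  x < S -> y < S -> a * S + x = b * S + y -> a = b /\ x = y.
Proof.
move=> xS yS eq_ab; have S_gt0 : 0 < S by apply: leq_ltn_trans xS.
split; first by move/(congr1 (divn^~ S)): eq_ab; rewrite !divnMDl // !divn_small ?addn0.
by move/(congr1 (modn^~ S)): eq_ab; rewrite !modnMDl !modn_small.
Qed.


Section SpinedTree.

Variables (G : sgraph) (r : G) (par : G -> G).
Hypothesis rootedG : rooted r par.

Variables (k : nat) (spine : seq G).
Hypotheses (size_spine : size spine = k.+2) (uniq_spine : uniq spine).
Hypothesis spine_root : nth r spine 0 = r.
Hypothesis spine_par : forall i, i <= k ->
  par (nth r spine i.+1) = nth r spine i.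

Let r_spine : r \in spine.
Proof. by rewrite -spine_root mem_nth ?size_spine. Qed.

Let index_root : index r spine = 0.
Proof. by rewrite -{1}spine_root index_uniq ?size_spine. Qed.

Let index_pos v : v \in spine -> v != r -> 0 < index v spine <= k.+1.
Proof.
move=> vP vr; have: index v spine < k.+2 by rewrite -size_spine index_mem.
rewrite ltnS => ->; rewrite andbT lt0n; apply: contra vr => /eqP i0.
by rewrite -(nth_index r vP) i0 spine_root.
Qed.

(** A vertex of the spine has at most one child on it, namely its successor; the
    last vertex has none, which the value 0 of [F] accounts for. *)
Lemma spine_sum (F : nat -> nat) (v : G) : F k.+2 = 0 ->
  \sum_(c in children r par v | c \in spine) F (index c spine) =
  if v \in spine then F (index v spine).+1 else 0.
Proof.
move=> F_last; have par_index c : c \in spine -> c != r ->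
    par c \in spine /\ index c spine = (index (par c) spine).+1.
  move=> cP cr; have /andP[i_gt0 i_le] := index_pos cP cr.
  have := spine_par (i := (index c spine).-1); rewrite prednK //.
  rewrite nth_index // => -> //; last by lia.
  by rewrite mem_nth ?size_spine ?index_uniq ?size_spine //; lia.
case: ifP => vP; last first.
  rewrite big1 // => c /andP[]; rewrite inE => /andP[cr /eqP cv] cP.
  by have [] := par_index c cP cr; rewrite cv vP.
have iv : index v spine < k.+2 by rewrite -size_spine index_mem.
case: (ltnP (index v spine) k.+1) => i_k.
  have lt_i : (index v spine).+1 < size spine by rewrite size_spine.
  rewrite (big_pred1 (nth r spine (index v spine).+1)) => [|c] /=.
    by rewrite index_uniq.
  apply/andP/eqP => [[] | ->].
    rewrite inE => /andP[cr /eqP cv] cP.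
    by have [_] := par_index c cP cr; rewrite cv => <-; rewrite nth_index.
  rewrite inE mem_nth // spine_par // nth_index // eqxx andbT; split=> //.
  apply/eqP => /(congr1 (index^~ spine)); rewrite index_root index_uniq //.
have iE : (index v spine).+1 = k.+2 by apply/eqP; rewrite eqn_leq iv.
rewrite iE F_last big1 //.
move=> c /andP[]; rewrite inE => /andP[cr /eqP cv] cP.
have [_ icE] := par_index c cP cr; have /andP[_] := index_pos cP cr.
by rewrite icE cv iE ltnn.
Qed.

Definition side_children (v : G) : {set G} :=
  [set c in [set c | c \notin spine] | par c == v].

Hypothesis even_side : forall v, ~~ odd #|side_children v|.
Hypothesis ends_neq : k = 0 ->
  #|side_children (nth r spine 0)| <> #|side_children (nth r spine 1)|.

(** Shifted by [lo], the vertex sums have quotient [Q v] and remainder [R v]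
    modulo [S]; the remainder is at most [lo.*2] exactly on the spine.  Off the
    spine the remainder determines the label of the vertex, on the spine the
    choice of the labels [a] excludes equal sums. *)
Lemma antimagic_of_spine : antimagic G.
Proof.
pose N := [set c | c \notin spine].
have card_N : #|G| = k.+2 + #|N|.
  rewrite -(cardC (mem spine)) (card_uniqP uniq_spine) size_spine.
  by congr (_ + _); apply: eq_card => c; rewrite !inE.
pose q v := #|side_children v|./2.
pose m := #|G|.-1.
have [lo [S [a labels_a]]] : exists lo S a,
    spine_labels k m (fun i => q (nth r spine i)) lo S a.
  apply: spine_labels_exist; first by rewrite /m card_N; lia.
  move=> k0 eq_q; apply: (ends_neq k0).
  by rewrite -[LHS]even_halfK ?even_side // -[RHS]even_halfK ?even_side // -/(q _) eq_q.
case: labels_a => S_eq lo_le a0 a_last a_range a_outer a_inj [rho [c [rhoE rho_inj]]].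
have m_eq : m = k.+1 + #|N| by rewrite /m card_N.
have [|f [f_inj f_range f_sum]] := pairing_labels (lo := lo) (S := S) even_side.
  by rewrite -/N; lia.
pose ell v := if v \in spine then a (index v spine) else f v.
have spineP v : v \in spine -> index v spine <= k.+1.
  by move=> vP; rewrite -ltnS -size_spine index_mem.
have rho_lt i : i <= k.+1 -> rho i < S.
  by move=> i_le; have [_] := rhoE i i_le; lia.
have NP v : v \notin spine -> v \in N by rewrite inE.
pose Q v := q v + (if v \in spine then c (index v spine) : nat else 0).
pose R v := if v \in spine then rho (index v spine) else f v + lo.
have R_lt v : R v < S.
  rewrite /R; case: ifPn => vP; first by rewrite rho_lt ?spineP.
  by have := f_range v (NP v vP); lia.
have sumE v : ell v + \sum_(x in children r par v) ell x + lo = Q v * S + R v.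
  have side_sum : \sum_(x in children r par v | x \notin spine) ell x = q v * S.
    rewrite /q -f_sum; apply: eq_big => x; last first.
      by move=> /andP[_ /negPf xP]; rewrite /ell xP.
    rewrite !inE; case: (eqVneq x r) => [->|_] /=; first by rewrite r_spine.
    by rewrite andbC.
  rewrite (bigID (mem spine)) /= side_sum.
  rewrite (eq_bigr (fun x => a (index x spine))); last first.
    by move=> x /andP[_ xP]; rewrite /ell xP.
  rewrite spine_sum //.
  rewrite /ell /Q /R; case: ifP => vP.
    by have [] := rhoE (index v spine) (spineP v vP); lia.
  by lia.
apply: (antimagic_of_vertex_labels rootedG (ell := ell)).
- by rewrite /ell r_spine index_root.
- move=> v; rewrite in_setC1 /ell => vr; case: ifPn => vP.
    by have := a_range _ (index_pos vP vr); lia.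
  by have := f_range v (NP v vP); lia.
- move=> v w; rewrite !in_setC1 /ell => vr wr.
  case: ifPn => vP; case: ifPn => wP.
  + move/(a_inj _ _ (index_pos vP vr) (index_pos wP wr)) => iE.
    by rewrite -(nth_index r vP) iE nth_index.
  + have := a_outer _ (index_pos vP vr).
    by have := f_range w (NP w wP); lia.
  + have := a_outer _ (index_pos wP wr).
    by have := f_range v (NP v vP); lia.
  + by apply: f_inj; apply: NP.
- move=> v w eq_vw.
  have : Q v * S + R v = Q w * S + R w by rewrite -!sumE eq_vw.
  case/quotient_inj => //; rewrite /Q /R.
  case: ifPn => vP; case: ifPn => wP.
  + move=> eqQ eqR; have qE u : u \in spine -> q (nth r spine (index u spine)) = q u.
      by move=> uP; rewrite nth_index.
    case: (ltngtP (index v spine) (index w spine)) => iE.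
    * have := rho_inj (index v spine) (index w spine).
      by rewrite iE spineP // !qE // => /(_ isT eqR); lia.
    * have := rho_inj (index w spine) (index v spine).
      by rewrite iE spineP // !qE // => /(_ isT (esym eqR)); lia.
    * by rewrite -(nth_index r vP) iE nth_index.
  + move=> _; have [_ rho_le] := rhoE _ (spineP v vP).
    by have := f_range w (NP w wP); lia.
  + move=> _; have [_ rho_le] := rhoE _ (spineP w wP).
    by have := f_range v (NP v vP); lia.
  + by move=> _ /addIn; apply: f_inj; apply: NP.
Qed.

End SpinedTree.

(** * Degrees in trees with at least two vertices *)

Section NontrivialTree.

Variable G : sgraph.
Hypotheses (treeG : tree G) (gt1G : 1 < #|G|).

Lemma sum_children r (par : G -> G) :
  \sum_v #|children r par v| = #|G|.-1.
Proof.
rewrite -(cardsC1 r) -sum1_card [RHS](partition_big par xpredT) //=.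
apply: eq_bigr => v _; rewrite -sum1_card; apply: eq_bigl => c.
by rewrite !inE.
Qed.

Lemma degree_gt0 (v : G) : 0 < degree v.
Proof.
have /card_gt0P[r]: 0 < #|[set~ v]| by rewrite cardsC1; lia.
rewrite in_setC1 eq_sym => vr.
by rewrite (degree_rooted (parent_rooted treeG r)) vr.
Qed.

(** The degrees are positive and add up to 2 (n - 1), which is less than 2 n. *)
Lemma exists_leaf : exists r : G, degree r = 1.
Proof.
have /card_gt0P[r _] := treeG.1.1.
case: (pickP (fun v : G => degree v == 1)) => [v /eqP | no_leaf]; first by exists v.
have sum_ge : \sum_(v : G) 2 <= \sum_(v : G) degree v.
  by apply: leq_sum => v _; have := degree_gt0 v; have := no_leaf v; lia.
have sum_eq : \sum_(v : G) degree v = #|G|.-1 + #|G|.-1.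
  rewrite (eq_bigr _ (fun v _ => degree_rooted (parent_rooted treeG r) v)).
  rewrite big_split /= sum_children; congr (_ + _).
  by rewrite -big_mkcond /= sum1_card -(cardsC1 r); apply: eq_card => v; rewrite !inE.
have sum_2 : \sum_(v : G) 2 = #|G| * 2.
  by rewrite sum_nat_const; congr (_ * _); apply: eq_card.
by exfalso; move: sum_ge; rewrite sum_eq sum_2; lia.
Qed.

(** Two adjacent leaves form a set closed under adjacency, hence the whole
    tree. *)
Lemma two_adjacent_leaves (r z : G) :
  adj r z -> degree r = 1 -> degree z = 1 -> is_K2 G.
Proof.
move=> rz; rewrite !degreeE => /eqP/cards1P[z' rE] /eqP/cards1P[r' zE].
have ? : z' = z by apply/esym/set1P; rewrite -rE inE.
have ? : r' = r by apply/esym/set1P; rewrite -zE inE adj_sym.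
subst z' r'.
have G_rz : [set: G] = [set r; z].
  apply/setP => x; rewrite [LHS]inE; apply/esym.
  have : closed (@adj G) (mem [set r; z]).
    apply: intro_closed; first by apply: sym_connect_sym; apply: adj_sym.
    move=> a b ab; rewrite !inE => /orP[]/eqP aE; move: ab; rewrite aE.
      by have := in_set1 b z; rewrite -rE inE => -> ->; rewrite orbT.
    by have := in_set1 b r; rewrite -zE inE => -> ->.
  move/closed_connect => /(_ _ _ (treeG.1.2 r x)).
  by rewrite !inE eqxx => <-.
have card2 : #|G| = 2.
  rewrite -cardsT G_rz cards2.
  by case: eqVneq rz => // ->; rewrite adj_irrefl.
split=> //; rewrite (card_edges_rooted (parent_rooted treeG r)).
by rewrite card2.
Qed.

End NontrivialTree.

(** * Extending the path of even vertices to a spine *)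

Lemma induces_path_seq (G : sgraph) (S : {set G}) : induces_path S ->
  exists w : seq G, [/\ uniq w, w =i S &
    forall x0 i j, i < size w -> j < size w ->
      adj (nth x0 w i) (nth x0 w j) = (i.+1 == j) || (j.+1 == i)].
Proof.
case=> n [f [g fK gK] adj_f].
exists [seq val (g i) | i <- enum 'I_n]; split.
- rewrite map_inj_uniq ?enum_uniq // => i j /val_inj eq_g.
  by rewrite -(gK i) eq_g gK.
- move=> x; apply/mapP/idP => [[i _ ->] | xS]; first exact: valP.
  by exists (f (Sub x xS)); rewrite ?mem_enum // fK.
- move=> x0 i j; rewrite size_map size_enum_ord => i_n j_n.
  have nthE h (h_n : h < n) :
      nth x0 [seq val (g i) | i <- enum 'I_n] h = val (g (Ordinal h_n)).
    rewrite (nth_map (Ordinal h_n)) ?size_enum_ord //.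
    by congr (val (g _)); apply: val_inj; rewrite /= nth_enum_ord.
  rewrite !nthE; have := adj_f (g (Ordinal i_n)) (g (Ordinal j_n)).
  by rewrite !gK.
Qed.

(** The degree of [v] counts its parent edge, the edge to its successor on the
    spine, if these exist, and its children off the spine.  Both edges exist
    exactly for the inner vertices of the spine, which are those of even degree;
    any other vertex has exactly one of them.  So the number of children off
    the spine is always even. *)
Lemma antimagic_of_rooted_path (G : sgraph) (r : G) (par : G -> G) (w : seq G) (z : G) :
    tree G -> ~ is_K2 G -> rooted r par ->
    w =i V_even G -> uniq (r :: rcons w z) ->
    path (fun a b => par b == a) r (rcons w z) ->
    (w = [::] -> degree r = 1) ->
  antimagic G.
Proof.
move=> treeG G_neq_K2 rootedG wE uniq_s path_s leaf_r.
set spine := r :: rcons w z.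
have size_s : size spine = (size w).+2 by rewrite /= size_rcons.
have spine_par i : i <= size w -> par (nth r spine i.+1) = nth r spine i.
  by move=> i_le; apply/eqP; move/pathP: path_s => -> //; rewrite size_rcons.
have index_s v : v \in spine -> index v spine <= (size w).+1.
  by move=> vs; rewrite -ltnS -size_s index_mem.
have degE v : degree v = (v != r) + #|side_children par spine v| +
    ((v \in spine) && (index v spine <= size w)).
  rewrite (degree_rooted rootedG) -addnA; congr (_ + _).
  rewrite -!sum1_card (bigID (mem spine)) /= addnC; congr (_ + _).
    apply: eq_bigl => c; rewrite !inE negb_or; case: (c == r) => //=.
    by rewrite andbC.
  rewrite (eq_bigr (fun c => (index c spine <= (size w).+1 : nat))); last first.
    by move=> c /andP[_ /index_s->].
  have -> := spine_sum size_s uniq_s erefl spine_par v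
    (_ : (fun i => i <= (size w).+1 : nat) _ = 0).
    by case: ifP.
  by rewrite ltnn.
have side_even v : ~~ odd #|side_children par spine v|.
  have: odd (degree v) = (v \notin w) by rewrite wE inE negbK.
  rewrite degE; have [vs | vs] := boolP (v \in spine); last first.
    move: vs; rewrite inE negb_or mem_rcons inE negb_or.
    by move=> /and3P[vr _ vw]; rewrite vr vw addn0 addnC addn1 /= => /negbTE ->.
  have [r_w z_w r_z] : [/\ r \notin w, z \notin w & r != z].
    move: uniq_s; rewrite /= mem_rcons inE negb_or rcons_uniq.
    by case/andP=> /andP[-> ->] /andP[->].
  have index_spine : index v spine = if v == r then 0 else
      if v \in w then (index v w).+1 else (size w + (v != z)).+1.
    rewrite /spine /= eq_sym; case: eqP => // _.
    rewrite -cats1 index_cat; case: ifP => // _ /=.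
    by rewrite eq_sym; case: eqP; rewrite ?addn0 ?addn1.
  rewrite andTb; move: vs index_spine; rewrite {1}/spine inE mem_rcons inE.
  case/or3P => [/eqP-> | /eqP-> | vw].
  - by rewrite eqxx r_w => -> /=; rewrite add0n addn1 /= => /negbTE->.
  - rewrite eq_sym (negPf r_z) (negPf z_w) eqxx addn0 => ->.
    by rewrite ltnn addn0 add1n /= => /negbTE->.
  - have vr : v != r by apply: contraNneq r_w => <-.
    rewrite (negPf vr) vw => ->; rewrite index_mem vw.
    by rewrite add1n addn1 /= negbK => ->.
apply: (antimagic_of_spine rootedG size_s uniq_s erefl spine_par side_even).
move=> /size0nil w0 /= side_eq; apply: G_neq_K2.
have side_r : #|side_children par spine r| = 0.
  have := leaf_r w0; rewrite degE eqxx mem_head /= eqxx /=; lia.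
move: path_s uniq_s; rewrite w0 /= andbT => /eqP par_z.
rewrite !inE andbT => r_z.
have z_r : z != r by rewrite eq_sym.
apply: (two_adjacent_leaves treeG (r := r) (z := z)); last 2 first.
- exact: leaf_r.
- rewrite degE z_r; move: side_eq; rewrite side_r {1}w0 /= => <-.
  by rewrite /spine w0 /= !inE (negPf r_z) eqxx orbT.
- by have := par_adj rootedG z_r; rewrite par_z adj_sym.
Qed.

(** A path leaving the root never turns back: if the parent of [w_i] were
    [w_(i+1)] rather than [w_(i-1)], a vertex would be repeated. *)
Lemma parent_chain (G : sgraph) (r : G) (par : G -> G) (w : seq G) :
    rooted r par -> uniq w -> r \notin w ->
    (forall i, i.+1 < size w -> adj (nth r w i) (nth r w i.+1)) ->
    (0 < size w -> adj (nth r w 0) r) ->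
  path (fun a b => par b == a) r w.
Proof.
move=> [_ adjP _] uw r_w adj_w adj_r.
apply/(pathP r); elim=> [|i IH] i_lt.
  by have [[_ ->] | []] := adjP _ _ (adj_r i_lt); rewrite ?eqxx.
have i_lt' := ltnW i_lt.
have [[_ par_i] | [_ ->]] := adjP _ _ (adj_w i i_lt); last by [].
have /eqP := IH i_lt'; rewrite par_i; case: i i_lt i_lt' {IH par_i} => [|i] /= i_lt i_lt'.
  by move=> eq_r; rewrite -eq_r mem_nth in r_w.
by move/eqP; rewrite nth_uniq // 1?ltnW // -[X in _ == X]addn0 -addn2 eqn_add2l.
Qed.

Theorem corollary1 (T : sgraph) (treeT : tree T) (T_neq_K2 : ~ is_K2 T)
    (even_path : induces_path (V_even T)) :
  antimagic T.
Proof.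
have [T_le1 | T_gt1] := leqP #|T| 1.
  have /card_gt0P[r _] := treeT.1.1.
  have all_r v : v = r by apply: (fintype_le1P T_le1).
  apply: (antimagic_of_vertex_labels (parent_rooted treeT r) (ell := fun=> 0)) => //.
  - by move=> v; rewrite (all_r v) !inE eqxx.
  - by move=> v w _ _ _; rewrite (all_r v) (all_r w).
  - by move=> v w _; rewrite (all_r v) (all_r w).
have [w [uw wE adj_w]] := induces_path_seq even_path.
(* With no vertex of even degree, the spine is the edge at a leaf. *)
have [w0 | w_gt0] := posnP (size w).
  have [r leaf_r] := exists_leaf treeT T_gt1.
  have rootedT := parent_rooted treeT r.
  have /card_gt0P[z] : 0 < #|children r (parent r) r|.
    by have := degree_rooted rootedT r; rewrite leaf_r eqxx add0n => <-.
  rewrite inE => /andP[z_r par_z].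
  apply: (antimagic_of_rooted_path (z := z) treeT T_neq_K2 rootedT wE) => //;
    by rewrite (size0nil w0) /= ?inE ?andbT // eq_sym.
have even_deg v : v \in w -> ~~ odd (degree v) by rewrite wE inE.
have /card_gt0P[x0 _] := treeT.1.1.
pose x := nth x0 w 0.
have xw : x \in w by rewrite mem_nth.
(* The first vertex of the path has even positive degree, but at most one
   neighbour on the path: some neighbour has odd degree and can be the root. *)
have /subsetPn[r xr r_w] : ~~ (neighbours x \subset w).
  apply: contra (even_deg x xw) => sub_w.
  suff: #|neighbours x| <= 1.
    by rewrite -degreeE; have := degree_gt0 treeT T_gt1 x; lia.
  rewrite -(cards1 (nth x0 w 1)); apply: subset_leq_card.
  apply/subsetP => c xc; have := subsetP sub_w c xc; move: xc; rewrite !inE.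
  move=> xc cw; move: xc; rewrite -(nth_index x0 cw) adj_w ?index_mem //.
  by rewrite orbF => /eqP <-.
have rootedT := parent_rooted treeT r.
have adj_next i : i.+1 < size w -> adj (nth r w i) (nth r w i.+1).
  by move=> i_lt; rewrite adj_w ?eqxx // ltnW.
have adj_first : 0 < size w -> adj (nth r w 0) r.
  by move=> _; move: xr; rewrite inE /x (set_nth_default r).
have chain := parent_chain rootedT uw r_w adj_next adj_first.
pose t := nth r w (size w).-1.
have last_t : last r w = t by rewrite (last_nth r) -{1}(prednK w_gt0).
have lt_t : (size w).-1 < size w by rewrite ltn_predL.
have tw : t \in w by exact: mem_nth.
(* The last vertex of the path has a parent and even degree, so it has a child,
   which cannot be its predecessor on the path. *)
have /card_gt0P[z] : 0 < #|children r (parent r) t|.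
  have := even_deg t tw; rewrite (degree_rooted rootedT).
  have -> : t != r by apply: contraNneq r_w => <-.
  by case: #|_|.
rewrite inE => /andP[z_r /eqP par_z].
have z_w : z \notin w.
  apply/negP => zw; have [parP _ asymP] := rootedT.
  have := parP z z_r; rewrite par_z -(nth_index r zw) /t adj_w ?index_mem //.
  have iz : index z w < size w by rewrite index_mem.
  case/orP => /eqP iE; last by move: iz; rewrite -iE prednK // ltnn.
  apply: (asymP z t) => //; first by apply: contraNneq r_w => <-.
  have /(pathP r)/(_ (size w).-1) := chain.
  rewrite prednK // => /(_ (leqnn _))/eqP.
  by rewrite -/t -{1}iE /= nth_index.
apply: (antimagic_of_rooted_path (z := z) treeT T_neq_K2 rootedT wE).
- by rewrite /= mem_rcons inE negb_or eq_sym z_r r_w rcons_uniq z_w.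
- by rewrite rcons_path chain last_t par_z eqxx.
- by move=> w0; rewrite w0 in w_gt0.
Qed.
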